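(* Let $(\mathcal A,(p_\ell)_{\ell\in\mathbb N})$ be a commutative semisimple Fréchet algebra. Then $\widehat{M(\mathcal A)}\subseteq C_{\mathrm{BSE}}(\Delta(\mathcal A))$ if and only if $\mathcal A$ has a bounded $\Delta$-weak approximate identity.
   Context: All locally convex spaces are Hausdorff. A Fréchet algebra $(\mathcal A,(p_\ell)_{\ell\in\mathbb N})$ is a complete topological (complex) algebra whose topology is generated by a countable increasing family of submultiplicative seminorms $(p_\ell)_{\ell\in\mathbb N}$. $\mathcal A^*$ is the topological dual. $\Delta(\mathcal A)$ is the Gelfand spectrum of $\mathcal A$ (nonzero continuous multiplicative linear functionals, with the weak$^*$ topology), and $C_b(\Delta(\mathcal A))$ is the algebra of bounded continuous complex-valued functions on $\Delta(\mathcal A)$. A commutative Fréchet algebra $\mathcal A$ is called semisimple if the Gelfand map $\mathcal A\to C_b(\Delta(\mathcal A))$, $a\mapsto\widehat a$, $\widehat a(\varphi)=\varphi(a)$, is injective; in other words, $\bigcap_{\varphi\in\Delta(\mathcal A)}\ker\varphi=\{0\}$. For a bounded set $M\subseteq\mathcal A$ and $f\in\mathcal A^*$ put $P_M(f)=\sup\{|f(a)|: a\in M\}$. A function $\sigma\in C_b(\Delta(\mathcal A))$ is a BSE-function if there exist a bounded set $M\subseteq\mathcal A$ and a positive real number $\beta_M$ such that for every finite collection $c_1,\dots,c_n\in\mathbb C$ and $\varphi_1,\dots,\varphi_n\in\Delta(\mathcal A)$, $\big|\sum_{i=1}^n c_i\sigma(\varphi_i)\big|\le\beta_M\,P_M\big(\sum_{i=1}^n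 c_i\varphi_i\big)$. The set of all BSE-functions is $C_{\mathrm{BSE}}(\Delta(\mathcal A))$. A multiplier on $\mathcal A$ is a map $T:\mathcal A\to\mathcal A$ with $T(a)b=aT(b)$ for all $a,b\in\mathcal A$; $M(\mathcal A)$ is the set of all multipliers. For $T\in M(\mathcal A)$, $\widehat T$ is the function on $\Delta(\mathcal A)$ given by $\widehat T(\varphi)=\varphi(T(a))/\varphi(a)$ for any $a\in\mathcal A$ with $\varphi(a)\ne0$ (independent of the choice of $a$), so that $\widehat{T(a)}=\widehat T\,\widehat a$ for all $a\in\mathcal A$; and $\widehat{M(\mathcal A)}=\{\widehat T: T\in M(\mathcal A)\}$. A bounded $\Delta$-weak approximate identity for $\mathcal A$ is a net $(e_\lambda)_\lambda$ in $\mathcal A$ such that $\{e_\lambda\}$ is a bounded subset of $\mathcal A$ and $\varphi(e_\lambda)\to1$ for every $\varphi\in\Delta(\mathcal A)$.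
   Formalization: Semisimple here also requires every Gelfand transform to be bounded and continuous, i.e. the Gelfand map really lands in C_b(Δ(A)); with only trivial intersection of kernels the claim fails, e.g. for C(ℝ) and the multiplier ''times x''. *)

(* Defs.v *)
From HB Require Import structures.
From mathcomp Require Import all_boot all_order all_algebra.
From mathcomp Require Import complex.
From mathcomp Require Import all_classical all_reals all_analysis.
Set Implicit Arguments.
Unset Strict Implicit.
Unset Printing Implicit Defensive.
Import Order.TTheory GRing.Theory Num.Theory.
Import numFieldNormedType.Exports.
Local Open Scope classical_set_scope.
Local Open Scope ring_scope.
Local Open Scope complex_scope.

Notation cmod := ComplexField.Normc.normc.

(* The product is a plain bilinear operation because the ring structures of
   the library are unital, which would make the existence of approximate
   identities trivial.
   The library's [tvsType] does not relate the uniform structure to the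
   addition; [fentourageE] says that the uniformity, hence also the topology
   and the notion of completeness, is the one of the seminorms.  Since the
   family is increasing, single seminorms give a base.  Joint continuity of
   the product follows from [fsnormM]. *)
HB.mixin Record isFrechetAlgebra (R : realType) A
    & Tvs R[i] A := {
  fmul : A -> A -> A ;
  fmulA : associative fmul ;
  fmulDl : left_distributive fmul +%R ;
  fmulDr : right_distributive fmul +%R ;
  fscalerAl : forall (c : R[i]) (a b : A), c *: fmul a b = fmul (c *: a) b ;
  fscalerAr : forall (c : R[i]) (a b : A), c *: fmul a b = fmul a (c *: b) ;
  fsnorm : nat -> A -> R ;
  fsnormD : forall l a b, fsnorm l (a + b) <= fsnorm l a + fsnorm l b ;
  fsnormZ : forall l (c : R[i]) a, fsnorm l (c *: a) = cmod c * fsnorm l a ;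
  fsnormM : forall l a b, fsnorm l (fmul a b) <= fsnorm l a * fsnorm l b ;
  fsnorm_incr : forall l a, fsnorm l a <= fsnorm l.+1 a ;
  fentourageE : forall E : set (A * A), entourage E <->
    exists l (eps : R), 0 < eps /\
      forall a b, fsnorm l (a - b) < eps -> E (a, b) ;
  fcomplete : forall F : set_system A, ProperFilter F -> cauchy F ->
    exists a : A, F --> a ;
  fhausdorff : hausdorff_space A
}.

#[short(type="frechetAlgType")]
HB.structure Definition FrechetAlgebra (R : realType) :=
  {A of isFrechetAlgebra R A & Tvs R[i] A}.

Section Frechet.
Context {R : realType}.
(* [R[i]^o] rather than [R[i]], as only the former carries a topology. *)
Local Notation C := (R[i]^o).

Definition fbounded (A : frechetAlgType R) (M : set A) :=
  forall l, exists K : R, forall a, M a -> fsnorm l a <= K.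

Definition is_character (A : frechetAlgType R) (phi : A -> C) :=
  [/\ scalar phi, continuous phi,
      forall a b, phi (fmul a b) = phi a * phi b
    & exists a, phi a != 0].

(* As a subspace of [{ptws A -> C}], the type associated with this set carries
   the topology of pointwise convergence, i.e. the weak-star topology. *)
Definition spectrum (A : frechetAlgType R) : set {ptws A -> C} :=
  [set phi | is_character phi].
Arguments spectrum A : clear implicits.

Definition character_fun (A : frechetAlgType R) (phi : spectrum A) : A -> C :=
  set_val phi.

Definition Cb (A : frechetAlgType R) : set (spectrum A -> C) :=
  [set s : spectrum A -> C | continuous s /\
    exists K : R, forall phi, cmod (s phi) <= K].
Arguments Cb A : clear implicits.

Definition gelfand (A : frechetAlgType R) (a : A) : spectrum A -> C :=
  fun phi => character_fun phi a.

(* That the Gelfand map takes its values in [Cb A] is part of the notion: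
   unlike for Banach algebras, boundedness of Gelfand transforms is not
   automatic (it fails for the continuous functions on the real line). *)
Definition semisimple (A : frechetAlgType R) :=
  (forall a : A, Cb A (gelfand a)) /\ injective (@gelfand A).

(* With the convention [sup set0 = 0], the supremum over an empty [M] is 0. *)
Definition PM (A : frechetAlgType R) (M : set A) (f : A -> C) : R :=
  sup [set cmod (f a) | a in M].

Definition CBSE (A : frechetAlgType R) : set (spectrum A -> C) :=
  [set s : spectrum A -> C | Cb A s /\
    exists M : set A, fbounded M /\
    exists beta : R, 0 < beta /\
    forall (n : nat) (c : 'I_n -> C) (phi : 'I_n -> spectrum A),
      cmod (\sum_i c i * s (phi i)) <=
        beta * PM M (fun a => \sum_i c i * character_fun (phi i) a)].
Arguments CBSE A : clear implicits.

Definition multiplier (A : frechetAlgType R) (T : A -> A) :=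
  forall a b, fmul (T a) b = fmul a (T b).

(* [xget] selects some [a] with [phi a != 0]; see [mult_hatE] for the
   independence of that choice. *)
Definition mult_hat (A : frechetAlgType R) (T : A -> A) : spectrum A -> C :=
  fun phi => let a := xget 0 [set a | character_fun phi a != 0] in
    character_fun phi (T a) / character_fun phi a.

Lemma mult_hatE (A : frechetAlgType R) (T : A -> A) (phi : spectrum A) (a : A) :
  multiplier T -> character_fun phi a != 0 ->
  mult_hat T phi = character_fun phi (T a) / character_fun phi a.
Proof.
move=> mT a0; rewrite /mult_hat /=.
have [_ _ phiM _] : is_character (character_fun phi) by exact: set_valP.
case: xgetP => [b _ /= b0|/(_ a)//].
apply: (mulIf a0); rewrite divfK// mulrAC.
by apply: (mulIf b0); rewrite divfK// -!phiM mT phiM mulrC -phiM.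
Qed.

Definition multipliers_hat (A : frechetAlgType R) : set (spectrum A -> C) :=
  [set mult_hat T | T in [set T : A -> A | multiplier T]].
Arguments multipliers_hat A : clear implicits.

Definition directed (I : Type) (le : I -> I -> Prop) :=
  [/\ inhabited I, forall i, le i i,
      forall i j k, le i j -> le j k -> le i k
    & forall i j, exists k, le i k /\ le j k].

(* The filter on [I] along which nets indexed by [(I, le)] converge. *)
Definition net_tails (I : Type) (le : I -> I -> Prop) : set_system I :=
  filter_from setT (fun i0 => [set i | le i0 i]).

Definition bounded_Delta_weak_approximate_identity (A : frechetAlgType R)
    (I : Type) (le : I -> I -> Prop) (e : I -> A) :=
  [/\ directed le, fbounded (range e)
    & forall phi : spectrum A,
        character_fun phi (e i) @[i --> net_tails le] --> (1 : C)].

Definition has_bounded_Delta_weak_approximate_identity (A : frechetAlgType R) :=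
  exists (I : Type) (le : I -> I -> Prop) (e : I -> A),
    bounded_Delta_weak_approximate_identity le e.

End Frechet.

Arguments spectrum {R} A.
Arguments Cb {R} A.
Arguments CBSE {R} A.
Arguments multipliers_hat {R} A.
Arguments semisimple {R} A.
Arguments has_bounded_Delta_weak_approximate_identity {R} A.

(* Main.v *)
(** If [1], the transform of the identity multiplier, is a BSE-function with
    witnesses [M] and [beta], then for finitely many characters the vector
    [(1, ..., 1)] lies in the closure of the image of the bounded absolutely
    convex set [{a | p_l a <= beta * sup_M p_l for all l}]; otherwise a linear
    form separating it from that image would contradict the BSE inequality.
    These approximations form the net.

    Conversely, semisimplicity makes a multiplier [T] linear with closed graph,
    hence bounded on bounded sets.  For a bounded approximate identity
    [(e_i)], [sum_k c_k hat T(phi_k)] is the limit of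
    [(sum_k c_k phi_k) (T e_i)], so the bounded set [{T e_i}] witnesses the BSE
    inequality.  Boundedness of [hat T] itself follows because the supremum norm
    of the Gelfand transform is a seminorm which is finite by hypothesis, hence
    continuous by Baire's argument. *)
Require Import Defs.
From mathcomp Require Import all_boot all_order all_algebra.
From mathcomp Require Import complex.
From mathcomp Require Import all_classical all_reals all_analysis.
From mathcomp Require Import ring lra.
Local Open Scope classical_set_scope.

Import Order.TTheory GRing.Theory Num.Theory.
Import numFieldNormedType.Exports.
Local Open Scope ring_scope.
Local Open Scope complex_scope.
Set Implicit Arguments.
Unset Strict Implicit.
Unset Printing Implicit Defensive.

(** * The real-valued modulus on [R[i]] *)

Section ComplexModulus.
Context {R : realType}.
Implicit Types x y : R[i].

Lemma cmod_ge0 x : 0 <= cmod x.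
Proof. by case: x => a b; rewrite /= sqrtr_ge0. Qed.

Lemma cmodD x y : cmod (x + y) <= cmod x + cmod y.
Proof. exact: le_normcD. Qed.

Lemma cmodN x : cmod (- x) = cmod x.
Proof. exact: normcN. Qed.

Lemma cmod_real (r : R) : cmod r%:C = `|r|.
Proof. by rewrite /= expr0n addr0 sqrtr_sqr. Qed.

Lemma sqr_cmod x : cmod x ^+ 2 = complex.Re x ^+ 2 + complex.Im x ^+ 2.
Proof. by case: x => a b; rewrite sqr_sqrtr ?addr_ge0 ?sqr_ge0. Qed.

Lemma Re_le_cmod x : complex.Re x <= cmod x.
Proof.
apply: le_trans (ler_norm _) _; rewrite -sqrtr_sqr.
by case: x => a b; rewrite ler_wsqrtr// lerDl sqr_ge0.
Qed.

Lemma cmod_sum (I : Type) (r : seq I) (F : I -> R[i]) :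
  cmod (\sum_(i <- r) F i) <= \sum_(i <- r) cmod (F i).
Proof.
elim/big_rec2: _ => [|i y z _ h]; first by rewrite ComplexField.Normc.normc0.
by apply: le_trans (cmodD _ _) _; rewrite lerD2l.
Qed.

(** The norm on [R[i]] takes its values in [R[i]]; a positive complex number has zero imaginary
    part, so real radii suffice. *)
Lemma cvg_cmodP (T : Type) (F : set_system T) (FF : Filter F)
    (f : T -> R[i]^o) (y : R[i]^o) :
  f x @[x --> F] --> y <->
  forall eps : R, 0 < eps -> \forall x \near F, cmod (f x - y) < eps.
Proof.
split=> [/cvgrPdist_lt h eps eps0|h].
  have := h eps%:C; rewrite ltcR => /(_ eps0); apply: filterS => x.
  by rewrite distrC [`|_|]/(_%:C) ltcR.
apply/cvgrPdist_lt => -[e e']; rewrite ltcE /= => /andP[/eqP -> e0].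
have := h _ e0; apply: filterS => x.
by rewrite distrC ltcE /= eqxx.
Qed.

Lemma cvg_mulC (T : Type) (F : set_system T) (FF : Filter F)
    (f g : T -> R[i]^o) (a b : R[i]^o) :
  f x @[x --> F] --> a -> g x @[x --> F] --> b ->
  f x * g x @[x --> F] --> (a * b : R[i]^o).
Proof. by move=> fa gb; exact: (@cvgM R[i] T F FF f g a b fa gb). Qed.

End ComplexModulus.

(** * Topology, completeness and continuity in terms of seminorms *)

Section FrechetTopology.
Context {R : realType} {A : frechetAlgType R}.
Implicit Types (a b : A) (l m : nat).
Local Notation p := (@fsnorm R A).
Local Notation C := (R[i]^o).

Lemma fsnorm0 l : p l 0 = 0.
Proof. by rewrite -(scale0r (0 : A)) fsnormZ ComplexField.Normc.normc0 mul0r. Qed.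

Lemma fsnormN l a : p l (- a) = p l a.
Proof. by rewrite -scaleN1r fsnormZ cmodN ComplexField.Normc.normc1 mul1r. Qed.

Lemma fsnorm_ge0 l a : 0 <= p l a.
Proof.
have := fsnormD l a (- a); rewrite subrr fsnorm0 fsnormN => h.
by lra.
Qed.

Lemma fsnorm_distC l a b : p l (a - b) = p l (b - a).
Proof. by rewrite -fsnormN opprB. Qed.

Lemma fsnorm_distD l a b c : p l (a - b) <= p l (a - c) + p l (c - b).
Proof. by apply: le_trans (fsnormD _ _ _); rewrite addrA subrK. Qed.

Lemma fsnorm_le l m a : (l <= m)%N -> p l a <= p m a.
Proof.
by move=> /subnK <-; elim: (m - l)%N => // n h; exact: le_trans h (fsnorm_incr _ _).
Qed.

Lemma nbhs_fsnormP a (U : set A) : nbhs a U <->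
  exists l (eps : R), 0 < eps /\ forall b, p l (a - b) < eps -> U b.
Proof.
split=> [/nbhsP[E /fentourageE[l [eps [eps0 h]]] EU]|[l [eps [eps0 h]]]].
  by exists l, eps; split=> // b /h ab; apply: EU; rewrite xsectionE.
apply/nbhsP; exists [set ab | p l (ab.1 - ab.2) < eps].
  by apply/fentourageE; exists l, eps.
by move=> b; rewrite xsectionE => /h.
Qed.

Lemma cvg_fsnormP (T : Type) (F : set_system T) (FF : Filter F)
    (f : T -> A) a : f x @[x --> F] --> a <->
  forall l (eps : R), 0 < eps -> \forall x \near F, p l (f x - a) < eps.
Proof.
split=> [h l eps eps0|h U /nbhs_fsnormP[l [eps [eps0 hU]]]].
  have /h : nbhs a [set b | p l (b - a) < eps].
    by apply/nbhs_fsnormP; exists l, eps; split=> // b; rewrite fsnorm_distC.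
  exact.
by have := h l _ eps0; apply: filterS => x; rewrite fsnorm_distC => /hU.
Qed.

Lemma fsnorm_cauchy_cvg (x : nat -> A) :
  (forall l (eps : R), 0 < eps ->
     exists N, forall n, (N <= n)%N -> p l (x n - x N) < eps) ->
  exists a, x n @[n --> \oo] --> a.
Proof.
move=> h; apply: fcomplete => E /fentourageE[l [eps [eps0 hE]]].
have [N hN] := h l (eps / 2) ltac:(by rewrite divr_gt0).
exists (x @` [set n | (N <= n)%N], x @` [set n | (N <= n)%N]) => /=.
  by split; exists N => // n /= Nn; exists n.
move=> [_ _] /= [[n /= Nn <-] [m /= Nm <-]]; apply: hE.
apply: le_lt_trans (fsnorm_distD _ _ _ (x N)) _.
have := hN _ Nn; have := hN _ Nm; rewrite (fsnorm_distC l (x m)) => ? ?.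
by lra.
Qed.

Lemma scalar_bound (phi : A -> C) : scalar phi -> continuous phi ->
  exists l (K : R), 0 <= K /\ forall a, cmod (phi a) <= K * p l a.
Proof.
move=> lphi cphi.
have phi0 : phi 0 = 0.
  have := lphi 1 0 0; rewrite scale1r addr0 mul1r => /eqP.
  by rewrite -subr_eq subrr => /eqP.
have phiZ c a : phi (c *: a) = c * phi a.
  by rewrite -[c *: a]addr0 lphi phi0 addr0.
have /cvg_cmodP/(_ 1 ltr01)/nbhs_fsnormP[l [eps [eps0 h]]] := cphi 0.
have hB a : p l a < eps -> cmod (phi a) < 1.
  by rewrite -fsnormN -sub0r => /h; rewrite phi0 subr0.
exists l, (2 / eps); split=> [|a]; first by rewrite divr_ge0// ltW.
have hr (r : R) : p l a < r -> 0 < r -> cmod (phi a) <= r / eps.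
  move=> ar r0.
  have := hB ((eps / r)%:C *: a); rewrite fsnormZ phiZ ComplexField.Normc.normcM.
  rewrite cmod_real gtr0_norm ?divr_gt0// mulrAC ltr_pdivrMr//.
  rewrite ltr_pM2l// => /(_ ar).
  by rewrite mulrAC ltr_pdivrMr// mul1r ler_pdivlMr// mulrC => /ltW.
(* [hr] needs [r] strictly above [p l a]. If [p l a = 0], an [r] proportional to [cmod (phi a)]
   forces [phi a = 0]; otherwise [r = 2 * p l a] explains the constant [2 / eps]. *)
have := fsnorm_ge0 l a; rewrite le_eqVlt => /orP[/eqP a0|a0].
  rewrite -a0 mulr0 leNgt; apply/negP => c0.
  have := hr (cmod (phi a) * eps / 2); rewrite -a0 !divr_gt0 ?mulr_gt0// => /(_ isT isT).
  rewrite mulrAC mulfK ?gt_eqF// leNgt => /negP; apply.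
  by lra.
have := hr (2 * p l a); rewrite mulr_gt0// mulrAC.
by apply => //; lra.
Qed.

End FrechetTopology.

(** * Baire category and the closed graph theorem *)

Section Baire.
Context {R : realType} {A : frechetAlgType R}.
Implicit Types (a b : A) (l m : nat).
Local Notation p := (@fsnorm R A).

Lemma fsnormZr l (r : R) a : 0 <= r -> p l (r%:C *: a) = r * p l a.
Proof. by move=> r0; rewrite fsnormZ cmod_real ger0_norm. Qed.

(* Nested balls replace an appeal to Baire's theorem: if the conclusion fails,
   every ball contains a smaller one on which [q > n], and a common point [x]
   of a sequence of such balls would have [q x = +oo]. *)
Lemma seminorm_unit_ball_dense_near0 (q : A -> R)
    (qD : forall a b, q (a + b) <= q a + q b)
    (qZ : forall (c : R[i]) a, q (c *: a) <= cmod c * q a) :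
  exists k (d : R), 0 < d /\ forall a, p k a < d ->
    forall m (eps : R), 0 < eps -> exists v, q v <= 1 /\ p m (a - v) < eps.
Proof.
apply: contrapT => H.
have {}H k (d : R) : 0 < d -> exists a m (eps : R), [/\ p k a < d, 0 < eps
    & forall v, q v <= 1 -> eps <= p m (a - v)].
  move=> d0; apply: contrapT => h; apply: H; exists k, d; split=> // a ad m eps e0.
  apply: contrapT => h'; apply: h; exists a, m, eps; split=> // v qv.
  by rewrite leNgt; apply/negP => pv; apply: h'; exists v.
have qB a b : q (a - b) <= q a + q b.
  apply: le_trans (qD _ _) _.
  rewrite lerD2l -scaleN1r; apply: le_trans (qZ _ _) _.
  by rewrite cmodN ComplexField.Normc.normc1 mul1r.
(* Let [a] be the point that [H] gives for radius [r / N]. If the claim failed, [x + N a] and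
   [x - N a] would be close to some [v1], [v2] with [q <= N], and [(v1 - v2) / (2 N)], where
   [q <= 1], would be too close to [a]. *)
have avoid (N : R) x k (r : R) : 0 < N -> 0 < r -> exists y m (eps : R),
    [/\ p k (x - y) < r, 0 < eps & forall v, q v <= N -> eps <= p m (y - v)].
  move=> N0 r0; have [a [m [eps [ak eps0 hv]]]] := H k (r / N) (divr_gt0 r0 N0).
  apply: contrapT => nh.
  have far y : p k (x - y) < r -> exists v, q v <= N /\ p m (y - v) < N * eps.
    move=> xy; apply: contrapT => nv; apply: nh; exists y, m, (N * eps).
    split; rewrite ?mulr_gt0// => v qv.
    by rewrite leNgt; apply/negP => pv; apply: nv; exists v.
  have Nak : p k (N%:C *: a) < r.
    by rewrite fsnormZr ?ltW// mulrC -ltr_pdivlMr.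
  have [v1 [qv1 pv1]] : exists v, q v <= N /\ p m (x + N%:C *: a - v) < N * eps.
    by apply: far; rewrite opprD addNKr fsnormN.
  have [v2 [qv2 pv2]] : exists v, q v <= N /\ p m (x - N%:C *: a - v) < N * eps.
    by apply: far; rewrite opprB addrC subrK.
  have c0 : 0 <= (2 * N)^-1 by rewrite invr_ge0 mulr_ge0// ltW.
  have : q ((2 * N)^-1%:C *: (v1 - v2)) <= 1.
    apply: le_trans (qZ _ _) _; rewrite cmod_real ger0_norm// mulrC ler_pdivrMr ?mulr_gt0//.
    by have := qB v1 v2; lra.
  move=> /hv; apply/negP; rewrite -ltNge.
  have -> : a - (2 * N)^-1%:C *: (v1 - v2) =
      (2 * N)^-1%:C *: ((x + N%:C *: a - v1) - (x - N%:C *: a - v2)).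
    have -> : x + N%:C *: a - v1 - (x - N%:C *: a - v2) =
       (N%:C *: a + N%:C *: a) - (v1 - v2).
      rewrite -(addrA x _ (- v1)) -(addrA x _ (- v2)) [- (x + _)]opprD (addrACA x) subrr add0r.
      by rewrite opprD !opprK opprB addrACA (addrC (- v1)).
    rewrite -scalerDl [in RHS]scalerBr scalerA -!rmorphD -rmorphM/=.
    have -> : (2 * N)^-1 * (N + N) = 1 by field; rewrite gt_eqF.
    by rewrite scale1r.
  rewrite fsnormZr// mulrC ltr_pdivrMr ?mulr_gt0//.
  apply: le_lt_trans (fsnormD _ _ _) _; rewrite fsnormN.
  by lra.
have step (ns : nat * (A * nat * R)) : exists t : A * nat * R, 0 < ns.2.2 ->
   [/\ (ns.1 <= t.1.2)%N, 0 < t.2, t.2 <= ns.1.+1%:R^-1 &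
     forall v, p t.1.2 (t.1.1 - v) <= t.2 ->
       p ns.2.1.2 (ns.2.1.1 - v) <= ns.2.2 /\ ns.1%:R < q v].
  case: ns => n [[x k] r] /=.
  have [r0|r0] := ltP 0 r; last by exists (x, k, r) => /=; lra.
  have [y [m [eps [xy eps0 hv]]]] := avoid n.+1%:R x k r (ltr0Sn _ _) r0.
  (* The three bounds keep the new closed ball inside the old one, keep it off the set [q <= n.+1],
     and make the radii tend to 0. The new index dominates [k], [m] and [n], so that the centres
     become Cauchy for every seminorm. *)
  pose s := Num.min (Num.min (r - p k (x - y)) (eps / 2)) n.+1%:R^-1.
  have s0 : 0 < s by rewrite !lt_min invr_gt0 ltr0Sn divr_gt0 // subr_gt0 xy.
  have [s1 s2 s3] : [/\ s <= r - p k (x - y), s <= eps / 2 & s <= n.+1%:R^-1].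
    by split; rewrite /s !ge_min lexx ?orbT.
  exists (y, maxn n (maxn k m), s) => /= _; split=> //; first exact: leq_maxl.
  move=> v hvs; split.
    apply: le_trans (fsnorm_distD _ _ _ y) _.
    have : p k (y - v) <= s.
      by apply: le_trans hvs; apply: fsnorm_le; rewrite !leq_max leqnn orbT.
    by lra.
  rewrite ltNge; apply/negP => qv.
  have : eps <= p m (y - v) by apply: hv; rewrite (le_trans qv)// ler_nat.
  have : p m (y - v) <= s.
    by apply: le_trans hvs; apply: fsnorm_le; rewrite !leq_max leqnn !orbT.
  by lra.
have [f hf] := choice step.
pose s := fix s n := if n is n'.+1 then f (n', s n') else ((0 : A), 0%N, (1 : R)).
have s_gt0 n : 0 < (s n).2.
  by elim: n => [|n ih] /=; [exact: ltr01 | have [] := hf (n, s n) ih].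
pose ball n := [set v | p (s n).1.2 ((s n).1.1 - v) <= (s n).2].
have ballS n v : ball n.+1 v -> ball n v /\ n%:R < q v.
  by move=> bv; have [_ _ _] := hf (n, s n) (s_gt0 n); apply.
have ball_le n m : (n <= m)%N -> ball m `<=` ball n.
  move=> /subnK <-; elim: (m - n)%N => // i ih v bv.
  by apply: ih; have [] := ballS _ _ bv.
have ball_center n : ball n (s n).1.1 by rewrite /ball/= subrr fsnorm0 ltW.
have index_ge n : (n <= (s n.+1).1.2)%N by have [] := hf (n, s n) (s_gt0 n).
have radius_le n : (s n.+1).2 <= n.+1%:R^-1 by have [] := hf (n, s n) (s_gt0 n).
have [|x xs] := fsnorm_cauchy_cvg (x := fun n => (s n).1.1).
  move=> l eps eps0.
  have [N0 epsN0] : exists N, N.+1%:R^-1 < eps.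
    have := cvgr_lt 0 (@cvg_harmonic R) eps eps0.
    by move=> [N _ /(_ N (leqnn _))]; exists N.
  exists (maxn l N0).+1 => n Nn; rewrite fsnorm_distC.
  apply: le_lt_trans (fsnorm_le _ (leq_trans (leq_maxl l N0) (index_ge _))) _.
  apply: le_lt_trans (ball_le _ _ Nn _ (ball_center n)) _.
  apply: le_lt_trans (radius_le _) _; apply: le_lt_trans epsN0.
  by rewrite lef_pV2 ?posrE ?ltr0Sn// ler_nat ltnS leq_maxr.
have xball n : ball n x.
  apply/ler_addgt0Pr => e e0.
  have /cvg_fsnormP/(_ (s n).1.2 e e0)[N _ hN] := xs.
  apply: le_trans (fsnorm_distD _ _ _ (s (maxn n N)).1.1) _; apply: lerD.
    exact: (ball_le n (maxn n N) (leq_maxl _ _) _ (ball_center _)).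
  by apply: ltW; apply: hN; exact: leq_maxr.
(* [ballS] at 0 gives [0 < q x], the sign condition of [archi_boundP]; [ballS] at the integer bound
   of [q x] then contradicts that bound. *)
have := ltW (archi_boundP (le_trans (ler0n _ _)
  (ltW (ballS 0%N x (xball 1%N)).2))).
by rewrite leNgt (ballS _ x (xball _)).2.
Qed.

(* Write a small [a] as [sum_n (r n - r n.+1)] with [r n] tending to [0] and
   [p (l + n) (T (r n - r n.+1)) <= 2 ^- n], so that [T (r n)] converges, and
   its limit can only be [0]. *)
Lemma closed_graph (T : A -> A) (T_lin : linear T)
    (T_closed : forall (x : nat -> A) b,
       x n @[n --> \oo] --> (0 : A) -> T (x n) @[n --> \oo] --> b -> b = 0) l :
  exists k (d : R), 0 < d /\ forall a, p k a < d -> p l (T a) <= 2.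
Proof.
have T0 : T 0 = 0.
  have := T_lin 1 0 0; rewrite !scale1r addr0 => /eqP.
  by rewrite -subr_eq subrr => /eqP.
have TZ c a : T (c *: a) = c *: T a by have := T_lin c a 0; rewrite T0 !addr0.
have TD a b : T (a + b) = T a + T b by have := T_lin 1 a b; rewrite !scale1r.
have TB a b : T (a - b) = T a - T b by rewrite -scaleN1r TD TZ scaleN1r.
have near_dense j : exists kd : nat * R, 0 < kd.2 /\ forall a, p kd.1 a < kd.2 ->
    forall m (eps : R), 0 < eps -> exists v, p j (T v) <= 1 /\ p m (a - v) < eps.
  have [||k [d h]] := @seminorm_unit_ball_dense_near0 (p j \o T).
  - by move=> a b /=; rewrite TD fsnormD.
  - by move=> c a /=; rewrite TZ fsnormZ.
  by exists (k, d).
have [kd hkd] := choice near_dense.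
pose g n : R := 2 ^- n.
have g0 n : 0 < g n by rewrite invr_gt0 exprn_gt0.
have gS n : g n.+1 = g n / 2 by rewrite /g exprSr invfM.
(* Dividing such an [a] by [g n] brings it into the ball where [hkd] applies to [p (l + n) \o T]. *)
pose small n a := p (kd (l + n)%N).1 a < (kd (l + n)%N).2 * g n.
have step (na : nat * A) : exists b, small na.1 na.2 ->
    [/\ small na.1.+1 b, p na.1 b < g na.1 & p (l + na.1)%N (T (na.2 - b)) <= g na.1].
  case: na => n a /=; have [sa|] := EM (small n a); last by exists 0.
  have [d0 hd] := hkd (l + n)%N; have [d1 _] := hkd (l + n.+1)%N.
  have gC : (g n)%:C * ((g n)^-1)%:C = 1 by rewrite -rmorphM/= divff// gt_eqF.
  have sa' : p (kd (l + n)%N).1 ((g n)^-1%:C *: a) < (kd (l + n)%N).2.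
    by rewrite fsnormZr ?invr_ge0 ?ltW// mulrC ltr_pdivrMr.
  (* The next remainder is [a - g n v]. The half in the accuracy turns [g n] into [g n.+1], as
     [small n.+1] requires; the bound 1 gives [p n b < g n]. *)
  have [|v [qv pv]] := hd _ sa' (maxn n (kd (l + n.+1)%N).1)
      (Num.min ((kd (l + n.+1)%N).2 / 2) 1).
    by rewrite lt_min ltr01 divr_gt0.
  have pv' j : (j <= maxn n (kd (l + n.+1)%N).1)%N ->
      p j (a - (g n)%:C *: v) < g n * Num.min ((kd (l + n.+1)%N).2 / 2) 1.
    move=> jle; rewrite -[a]scale1r -gC -scalerA -scalerBr fsnormZr ?ltW//.
    by rewrite ltr_pM2l// (le_lt_trans (fsnorm_le _ jle)).
  exists (a - (g n)%:C *: v) => _; split.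
  - apply: lt_le_trans (pv' _ (leq_maxr _ _)) _.
    rewrite gS mulrCA ler_pM2l// ge_min.
    by rewrite lexx.
  - apply: lt_le_trans (pv' _ (leq_maxl _ _)) _.
    by rewrite -[X in _ <= X]mulr1 ler_pM2l// ge_min lexx orbT.
  - rewrite opprB addrC subrK TZ fsnormZr ?(ltW (g0 n))//.
    by rewrite -[X in _ <= X]mulr1 ler_pM2l.
have [f hf] := choice step.
exists (kd l).1, (kd l).2; split=> [|a ak]; first exact: (hkd l).1.
pose r := fix r n := if n is n'.+1 then f (n', r n') else a.
have rsmall n : small n (r n).
  elim: n => [|n ih] /=; last by have [] := hf (n, r n) ih.
  by rewrite /small /= addn0 /g expr0 invr1 mulr1.
have r_lt n : p n (r n.+1) < g n by have [] := hf (n, r n) (rsmall n).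
have Tr_le n : p (l + n)%N (T (r n) - T (r n.+1)) <= g n.
  by rewrite -TB; have [] := hf (n, r n) (rsmall n).
(* The right-hand side is the geometric sum of [g i] for [n <= i < m]; from [n = 0] it yields the
   final bound 2. *)
have Tr_dist j n m : (j <= l + n)%N -> (n <= m)%N ->
    p j (T (r n) - T (r m)) <= 2 * g n - 2 * g m.
  move=> jn /subnK <-; elim: (m - n)%N => [|i ih]; first by rewrite !subrr fsnorm0.
  rewrite addSn; apply: le_trans (fsnorm_distD _ _ _ (T (r (i + n)%N))) _.
  have : p j (T (r (i + n)%N) - T (r (i + n).+1)) <= g (i + n)%N.
    apply: le_trans (Tr_le _); apply: fsnorm_le.
    by rewrite (leq_trans jn)// leq_add2l leq_addl.
  by rewrite gS; lra.
have g_small (eps : R) : 0 < eps -> exists N, forall n, (N <= n)%N -> g n < eps.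
  move=> eps0.
  have gcvg : g n @[n --> \oo] --> 0.
    rewrite (_ : g = GRing.exp 2^-1); last by apply/funext => n; rewrite /g exprVn.
    by apply: cvg_expr; rewrite ger0_norm ?invr_ge0// invf_lt1// ltr1n.
  have := cvgr_lt 0 gcvg eps eps0.
  by move=> [N _ hN]; exists N => n; exact: hN.
have r0 : r n @[n --> \oo] --> (0 : A).
  apply/cvg_fsnormP => j eps eps0; have [N hN] := g_small _ eps0.
  exists (maxn j N).+1 => // -[//|n] /= nN; rewrite subr0.
  apply: le_lt_trans (hN n (leq_trans (leq_maxr _ _) nN)).
  exact: le_trans (fsnorm_le _ (leq_trans (leq_maxl _ _) nN)) (ltW (r_lt n)).
have [|b Tb] := fsnorm_cauchy_cvg (x := T \o r).
  move=> j eps eps0; have [N hN] := g_small (eps / 2) ltac:(by rewrite divr_gt0).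
  exists (maxn j N) => n nN; rewrite fsnorm_distC.
  have jl : (j <= l + maxn j N)%N by rewrite (leq_trans (leq_maxl j N))// leq_addl.
  apply: le_lt_trans (Tr_dist _ _ _ jl nN) _.
  by have := g0 n; have := hN _ (leq_maxr j N); lra.
have b0 := T_closed _ _ r0 Tb; rewrite {}b0 in Tb.
apply/ler_addgt0Pr => e e0.
have /cvg_fsnormP/(_ l e e0)[N _ /(_ N (leqnn _))/=] := Tb; rewrite subr0 => TN.
rewrite -[T a](subrK (T (r N))); apply: le_trans (fsnormD _ _ _) _; apply: lerD (ltW TN).
apply: le_trans (Tr_dist l 0%N N (leq_addr _ _) (leq0n _)) _.
by have := g0 N; rewrite /g expr0 invr1; lra.
Qed.

End Baire.

(** * Separating a point from a convex set in finite dimension *)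

Section Separation.
Context {R : realType}.

Lemma Re_sum (I : Type) (r : seq I) (F : I -> R[i]) :
  complex.Re (\sum_(i <- r) F i) = \sum_(i <- r) complex.Re (F i).
Proof.
by elim/big_rec2: _ => [//|i y z _ <-]; case: (F i) z => ? ? [].
Qed.

(** A nearest point of [K] may not exist, so a point [u] almost attaining the infimum [d] of the
    squared distances is used. The functional is the inner product with [z - u], and the gap is
    [d / 2]. *)
Lemma convex_point_separation n (K : set ('I_n -> R[i])) (z : 'I_n -> R[i])
    (B eps : R) :
  (forall u v (t : R), K u -> K v -> 0 <= t <= 1 ->
     K (fun i => u i + t%:C * (v i - u i))) ->
  K !=set0 -> (forall u i, K u -> cmod (u i) <= B) ->
  0 < eps -> (forall u, K u -> exists i, eps <= cmod (z i - u i)) ->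
  exists (c : 'I_n -> R[i]) (eta : R), 0 < eta /\ forall u, K u ->
    complex.Re (\sum_i c i * u i) + eta <= complex.Re (\sum_i c i * z i).
Proof.
move=> Kconv [u0 Ku0] KB eps0 far.
pose N u := \sum_i cmod (z i - u i) ^+ 2.
have N_ge0 u : 0 <= N u by apply: sumr_ge0 => i _; exact: sqr_ge0.
have hinf : has_inf (N @` K).
  by split; [exists (N u0), u0 | exists 0 => _ [u _ <-]].
set d := inf (N @` K).
have d_le u : K u -> d <= N u by move=> Ku; apply: ge_inf hinf.2 _ _; exists u.
have d0 : 0 < d.
  apply: lt_le_trans (_ : eps ^+ 2 <= _); first exact: exprn_gt0.
  apply: lb_le_inf hinf.1 _ => _ [u Ku <-]; have [i zi] := far u Ku.
  rewrite /N (bigD1 i)//= -[leLHS]addr0 lerD ?sumr_ge0// => [|j _]; last exact: sqr_ge0.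
  by rewrite ler_sqr ?nnegrE ?cmod_ge0// ltW.
pose L := n%:R * (2 * B) ^+ 2.
have L0 : 0 <= L by rewrite mulr_ge0// sqr_ge0.
have KL u v : K u -> K v -> \sum_i cmod (v i - u i) ^+ 2 <= L.
  move=> Ku Kv; rewrite /L mulr_natl -[X in _ *+ X](card_ord n) -sumr_const.
  apply: ler_sum => i _; have := cmodD (v i) (- u i).
  have := KB u i Ku; have := KB v i Kv; have := cmod_ge0 (v i - u i).
  by rewrite cmodN => *; rewrite ler_sqr ?nnegrE; lra.
(* [t <= 1] allows the convex combination, and [t * (1 + L) <= d] lets the error cost at most half
   of the gap [d]. Here [L] bounds squared distances within [K], and [u] is optimal up to
   [t ^+ 2]. *)
pose t := d / (1 + L + d).
have t0 : 0 < t by rewrite divr_gt0//; lra.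
have t1 : t <= 1 by rewrite ler_pdivrMr; lra.
have tL : t * (1 + L) <= d.
  by rewrite mulrAC ler_pdivrMr; nra.
have [_ [u Ku <-] Nu] := inf_adherent (exprn_gt0 2 t0) hinf.
rewrite -/d in Nu.
pose c i := ((z i - u i)^*)%C.
exists c, (d / 2); split=> [|v Kv]; first by rewrite divr_gt0.
(* [u] is a nearly closest point of [K] to [z]; moving from [u] towards [v] by
   the step [t] cannot decrease the distance by much. *)
have expand : N (fun i => u i + t%:C * (v i - u i)) = N u
    - 2 * t * (complex.Re (\sum_i c i * v i) - complex.Re (\sum_i c i * u i))
    + t ^+ 2 * \sum_i cmod (v i - u i) ^+ 2.
  rewrite !Re_sum -sumrB !mulr_sumr -sumrB -big_split /=; apply: eq_bigr => i _.
  rewrite !sqr_cmod /c; case: (z i) (u i) (v i) => [x1 x2] [y1 y2] [w1 w2] /=.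
  by ring.
have Nuz : N u = complex.Re (\sum_i c i * z i) - complex.Re (\sum_i c i * u i).
  rewrite !Re_sum -sumrB; apply: eq_bigr => i _.
  rewrite sqr_cmod /c; case: (z i) (u i) => [x1 x2] [y1 y2] /=.
  by ring.
have := d_le _ (Kconv u v t Ku Kv _); rewrite t1 ltW// expand => /(_ isT).
have := KL u v Ku Kv; set S := (\sum_i cmod (v i - u i) ^+ 2) => SL h.
have {}h : 2 * t * (complex.Re (\sum_i c i * v i) - complex.Re (\sum_i c i * u i))
    <= t * (t * (1 + L)).
  have : t ^+ 2 * S <= t ^+ 2 * L by rewrite ler_pM2l ?exprn_gt0.
  by nra.
move: h; rewrite [2 * t]mulrC -mulrA ler_pM2l// => h.
have := d_le u Ku; rewrite Nuz.
by lra.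
Qed.

End Separation.

(** * Nets, characters and bounded sets *)

Lemma net_tails_proper (I : Type) (le : I -> I -> Prop) :
  directed le -> ProperFilter (net_tails le).
Proof.
move=> [[i0] le_refl le_trans le_dir].
apply: filter_from_proper => [|i _]; last by exists i => /=.
apply: filter_from_filter; first by exists i0.
move=> i j _ _; have [k [ik jk]] := le_dir i j.
by exists k => // x /= kx; split; exact: le_trans kx.
Qed.

Section Spectrum.
Context {R : realType} {A : frechetAlgType R}.
Implicit Types (a b : A) (l m : nat) (phi : spectrum A).
Local Notation p := (@fsnorm R A).
Local Notation C := (R[i]^o).
Local Notation chi := character_fun.

Lemma character_funP phi : is_character (chi phi).
Proof. exact: set_valP. Qed.

Lemma character_funM phi a b : chi phi (fmul a b) = chi phi a * chi phi b.
Proof. by have [] := character_funP phi. Qed.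

Lemma character_fun_scalar phi : scalar (chi phi).
Proof. by have [] := character_funP phi. Qed.

Lemma character_fun0 phi : chi phi 0 = 0.
Proof.
have := character_fun_scalar phi 1 0 0.
by rewrite scale1r addr0 mul1r => /eqP; rewrite -subr_eq subrr => /eqP.
Qed.

Lemma character_funZ phi c a : chi phi (c *: a) = c * chi phi a.
Proof. by have := character_fun_scalar phi c a 0; rewrite character_fun0 !addr0. Qed.

Lemma character_funD phi a b : chi phi (a + b) = chi phi a + chi phi b.
Proof. by have := character_fun_scalar phi 1 a b; rewrite scale1r mul1r. Qed.

(** [K] is chosen before [q], which makes the bound uniform over all characters. In the proof,
    [|K| + 1] guards against a negative bound when [M] is empty. *)
Lemma fbounded_homogeneous (M : set A) k (d c : R) : fbounded M -> 0 < d ->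
  exists K : R, forall q : A -> R,
    (forall (s : R[i]) a, q (s *: a) = cmod s * q a) ->
    (forall a, p k a < d -> q a <= c) -> forall a, M a -> q a <= K.
Proof.
move=> /(_ k)[K MK] d0; exists ((`|K| + 1) / d * c) => q qZ qc a /MK aK.
have K0 : 0 < `|K| + 1 by have := normr_ge0 K; lra.
have s0 : 0 < d / (`|K| + 1) by rewrite divr_gt0.
have : p k ((d / (`|K| + 1))%:C *: a) < d.
  rewrite fsnormZr ?ltW// mulrAC ltr_pdivrMr// ltr_pM2l//.
  by have := ler_norm K; lra.
move=> /qc; rewrite qZ cmod_real gtr0_norm// -ler_pdivlMl//.
by rewrite invf_div.
Qed.

Lemma character_fun_bounded phi (M : set A) : fbounded M ->
  exists K : R, forall a, M a -> cmod (chi phi a) <= K.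
Proof.
have [lphi cphi _ _] := character_funP phi.
have [l [K [K0 h]]] := scalar_bound lphi cphi.
move=> /(_ l)[B MB]; exists (K * B) => a /MB aB.
by apply: le_trans (h a) _; rewrite ler_wpM2l.
Qed.

(** [sup] is an upper bound only for a set bounded above, which boundedness of [M] ensures. *)
Lemma le_PM (M : set A) n (c : 'I_n -> C) (phi : 'I_n -> spectrum A) a :
  fbounded M -> M a -> cmod (\sum_i c i * chi (phi i) a) <=
    PM M (fun a => \sum_i c i * chi (phi i) a).
Proof.
move=> Mbd Ma.
have [B hB] := choice (fun i => character_fun_bounded (phi i) Mbd).
apply: ub_le_sup; last by exists a.
exists (\sum_i cmod (c i) * B i) => _ [b Mb <-].
apply: le_trans (cmod_sum _ _) _; apply: ler_sum => i _.
by rewrite ComplexField.Normc.normcM ler_wpM2l ?cmod_ge0// hB.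
Qed.

(** Reduces nets to approximation on finite families of characters. Conversely, the net is indexed
    by a finite list of characters and a precision, preordered by inclusion and size. *)
Lemma has_bounded_Delta_weak_approximate_identityP :
  has_bounded_Delta_weak_approximate_identity A <->
  exists M : set A, fbounded M /\
    forall n (phi : 'I_n -> spectrum A) (eps : R), 0 < eps ->
      exists a, M a /\ forall i, cmod (chi (phi i) a - 1) < eps.
Proof.
split=> [[I [le [e [le_directed ebd e1]]]]|[M [Mbd M1]]].
  have PF := net_tails_proper le_directed.
  exists (range e); split=> // n phi eps eps0.
  have /filter_ex[x hx] : \forall x \near net_tails le,
      forall i, cmod (chi (phi i) (e x) - 1) < eps.
    by apply: filter_forall => i; exact: ((cvg_cmodP _ _ _).1 (e1 (phi i))).
  by exists (e x); split=> //; exists x.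
pose le (s t : seq (spectrum A) * nat) :=
  {subset s.1 <= t.1} /\ (s.2 <= t.2)%N.
have approx (s : seq (spectrum A) * nat) : exists a, M a /\
    forall phi, phi \in s.1 -> cmod (chi phi a - 1) < s.2.+1%:R^-1.
  have [|a [Ma ha]] := M1 _ (tnth (in_tuple s.1)) s.2.+1%:R^-1.
    by rewrite invr_gt0.
  by exists a; split=> // phi /(tnthP (in_tuple s.1))[i ->].
have [e he] := choice approx.
have le_directed : directed le.
  split=> [|s|s t u [st1 st2] [tu1 tu2]|s t].
  - exact: (inhabits ([::], 0%N)).
  - by split.
  - by split=> [x /st1/tu1|] //; exact: leq_trans tu2.
  - exists (s.1 ++ t.1, maxn s.2 t.2); split; split=> /=.
    + by move=> x xs; rewrite mem_cat xs.
    + exact: leq_maxl.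
    + by move=> x xs; rewrite mem_cat xs orbT.
    + exact: leq_maxr.
exists (seq (spectrum A) * nat)%type, le, e; split=> // [l|phi].
  by have [K MK] := Mbd l; exists K => _ [s _ <-]; apply: MK; have [] := he s.
have PF := net_tails_proper le_directed.
apply/cvg_cmodP => eps eps0.
have [N _ hN] := near_infty_natSinv_lt (PosNum eps0).
exists ([:: phi], N) => // s [/= s1 s2]; have [_ h] := he s.
apply: lt_trans (h phi (s1 _ (mem_head _ _))) _.
exact: hN.
Qed.

Lemma mult_hatM (T : A -> A) phi a : multiplier T ->
  chi phi (T a) = mult_hat T phi * chi phi a.
Proof.
move=> mT; have [a0|a0] := eqVneq (chi phi a) 0; last by rewrite (mult_hatE mT a0) divfK.
(* When [phi] kills [a], the product of [phi (T a)] and [phi b] equals that of [phi a] and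
   [phi (T b)], which is 0. *)
have [_ _ _ [b b0]] := character_funP phi.
rewrite a0 mulr0; apply: (mulIf b0).
by rewrite mul0r -character_funM mT character_funM a0 mul0r.
Qed.

Lemma fsnorm_ball_bounded (K : nat -> R) : fbounded [set a : A | forall l, p l a <= K l].
Proof. by move=> l; exists (K l) => a; apply. Qed.

(** * Multipliers of a semisimple algebra *)

Section Semisimple.
Hypothesis ssA : semisimple A.

(** A uniform boundedness principle for the characters, whose pointwise supremum [q] is finite by
    semisimplicity. *)
Lemma gelfand_norm_bounded (M : set A) : fbounded M ->
  exists K : R, forall a, M a -> forall phi, cmod (chi phi a) <= K.
Proof.
have [[phi0]|nphi] := EM (inhabited (spectrum A)); last first.
  by exists 0 => a _ phi; case: nphi.
pose q a := sup (range (fun phi => cmod (chi phi a))).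
have q_ge phi a : cmod (chi phi a) <= q a.
  have [_ [K hK]] := ssA.1 a.
  by apply: ub_le_sup; [exists K => _ [psi _ <-]; exact: hK | exists phi].
have q_le a K : (forall phi, cmod (chi phi a) <= K) -> q a <= K.
  by move=> h; apply: ge_sup; [exists (cmod (chi phi0 a)), phi0 | move=> _ [phi _ <-]].
have qD a b : q (a + b) <= q a + q b.
  apply: q_le => phi; rewrite character_funD.
  by apply: le_trans (cmodD _ _) _; rewrite lerD.
have qZ c a : q (c *: a) <= cmod c * q a.
  apply: q_le => phi; rewrite character_funZ ComplexField.Normc.normcM.
  by rewrite ler_wpM2l ?cmod_ge0.
have [k [d [d0 qd]]] := seminorm_unit_ball_dense_near0 qD qZ.
(* Approximation by points with [q <= 1] is enough because each character is continuous: [m] and [K]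
   depend on [phi], the resulting bound 1 does not. *)
have chi_near0 phi a : p k a < d -> cmod (chi phi a) <= 1.
  move=> ad; apply/ler_addgt0Pr => e e0.
  have [lphi cphi _ _] := character_funP phi.
  have [m [K [K0 hK]]] := scalar_bound lphi cphi.
  have [|v [qv pv]] := qd a ad m (e / (K + 1)); first by rewrite divr_gt0//; lra.
  rewrite -[a](subrK v) addrC character_funD; apply: le_trans (cmodD _ _) _.
  apply: lerD; first exact: le_trans (q_ge _ _) qv.
  apply: le_trans (hK _) _; move: pv; rewrite ltr_pdivlMr; last by lra.
  by have := fsnorm_ge0 m (a - v); nra.
move=> Mbd; have [K hK] := fbounded_homogeneous k 1 Mbd d0.
exists K => a Ma phi; apply: (hK (fun a => cmod (chi phi a)) _ _ a Ma) => [s b|b].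
  by rewrite character_funZ ComplexField.Normc.normcM.
exact: chi_near0.
Qed.

(** Each character turns [T] into multiplication by a number, and characters separate points. *)
Lemma multiplier_linear (T : A -> A) : multiplier T -> linear T.
Proof.
move=> mT c a b; apply: ssA.2; apply/funext => phi; rewrite /gelfand.
rewrite character_funD character_funZ !(mult_hatM _ _ mT) character_funD character_funZ.
by rewrite mulrDr mulrCA.
Qed.

(** The graph is closed: if [x n] tends to 0 and [T (x n)] to [b], every character sends [b] to a
    multiple of 0. *)
Lemma multiplier_bounded (T : A -> A) (M : set A) :
  multiplier T -> fbounded M -> fbounded (T @` M).
Proof.
move=> mT Mbd l; have lT := multiplier_linear mT.
have [x b x0 Tb|k [d [d0 Td]]] := @closed_graph R A T lT _ l.
  apply: ssA.2; apply/funext => phi; rewrite /gelfand character_fun0.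
  have [_ cphi _ _] := character_funP phi.
  have h1 : mult_hat T phi * chi phi (x n) @[n --> \oo] --> (chi phi b : C).
    under eq_cvg do rewrite -mult_hatM//.
    by apply: continuous_cvg; [exact: cphi | exact: Tb].
  have h2 : mult_hat T phi * chi phi (x n) @[n --> \oo] --> (mult_hat T phi * 0 : C).
    apply: cvg_mulC; first exact: cvg_cst.
    by rewrite -(character_fun0 phi); apply: continuous_cvg; [exact: cphi | exact: x0].
  rewrite -[RHS](mulr0 (mult_hat T phi)).
  exact: (cvg_unique _ h1 h2).
have [K hK] := fbounded_homogeneous k 2 Mbd d0.
exists K => _ [a Ma <-]; apply: (hK (p l \o T)) => // s b /=.
have T0 : T 0 = 0.
  have := lT 1 0 0; rewrite !scale1r addr0 => /eqP.
  by rewrite -subr_eq subrr => /eqP.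
by have := lT s b 0; rewrite T0 !addr0 => ->; rewrite fsnormZ.
Qed.

(** The element picked by [xget] varies with the character, so one [a] with [phi a != 0] is fixed;
    near [phi] the function is a quotient of two Gelfand transforms. *)
Lemma mult_hat_continuous (T : A -> A) :
  multiplier T -> continuous (mult_hat T : spectrum A -> C).
Proof.
move=> mT phi; have [_ _ _ [a a0]] := character_funP phi.
have [ca _] := ssA.1 a; have [cTa _] := ssA.1 (T a).
have near_ne0 : \forall psi \near phi, gelfand a psi != 0.
  have /cvg_cmodP/(_ (cmod (chi phi a))) := ca phi.
  have c0 : 0 < cmod (chi phi a).
    rewrite lt_neqAle cmod_ge0 andbT eq_sym; apply: contra a0 => /eqP.
    by move=> /ComplexField.Normc.eq0_normc ->.
  move=> /(_ c0); apply: filterS => psi; rewrite /gelfand; apply: contraTneq => ->.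
  by rewrite sub0r cmodN ltxx.
have quot : gelfand (T a) psi / gelfand a psi @[psi --> phi] --> (mult_hat T phi : C).
  rewrite (mult_hatE mT a0); 
  exact: (@cvg_mulC R _ _ _ (gelfand (T a)) (fun psi => (gelfand a psi)^-1) _ _
            (cTa phi) (@cvgV R[i] _ _ _ (gelfand a) _ a0 (ca phi))).
have quot_eq : \forall psi \near phi, gelfand (T a) psi / gelfand a psi = mult_hat T psi.
  by apply: filterS near_ne0 => psi a_ne0; rewrite (mult_hatE mT a_ne0).
exact: (cvg_trans (near_eq_cvg quot_eq) quot).
Qed.

Lemma mult_hat_CBSE (T : A -> A) : multiplier T ->
  has_bounded_Delta_weak_approximate_identity A -> CBSE A (mult_hat T).
Proof.
move=> mT /has_bounded_Delta_weak_approximate_identityP[M [Mbd M1]].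
have TMbd := multiplier_bounded mT Mbd.
split; first split; first exact: mult_hat_continuous.
  (* An [a] in [M] with [phi a] within 1/2 of 1 has modulus at least 1/2 under [phi], whence the
     factor 2. *)
  have [K hK] := gelfand_norm_bounded TMbd; exists (2 * K) => phi.
  have [|a [Ma /(_ ord0) ha]] := M1 1%N (fun _ => phi) 2^-1; first by rewrite invr_gt0.
  have := hK _ (imageP T Ma) phi; rewrite (mult_hatM _ _ mT) ComplexField.Normc.normcM.
  have := cmodD (chi phi a) (1 - chi phi a); rewrite addrC subrK -[1 - _]opprB cmodN.
  rewrite ComplexField.Normc.normc1; have := cmod_ge0 (mult_hat T phi).
  by nra.
exists (T @` M); split=> //; exists 1; split=> // n c phi; rewrite mul1r.
apply/ler_addgt0Pr => e e0.
pose S := \sum_i cmod (c i * mult_hat T (phi i)).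
have S0 : 0 <= S by apply: sumr_ge0 => i _; exact: cmod_ge0.
have [|a [Ma ha]] := M1 n phi (e / (S + 1)); first by rewrite divr_gt0//; lra.
(* The first sum is controlled by [PM] on the image of [M]; the second is at most
   [S * (e / (S + 1))], hence at most [e]. *)
have -> : \sum_i c i * mult_hat T (phi i) = \sum_i c i * chi (phi i) (T a)
    - \sum_i c i * mult_hat T (phi i) * (chi (phi i) a - 1).
  rewrite -sumrB; apply: eq_bigr => i _; rewrite (mult_hatM _ _ mT).
  by rewrite mulrBr mulr1 opprB mulrA addrCA subrr addr0.
apply: le_trans (cmodD _ _) _; apply: lerD; first by apply: le_PM => //; exists a.
rewrite cmodN; apply: le_trans (cmod_sum _ _) _.
apply: le_trans (_ : S * (e / (S + 1)) <= _).
  rewrite mulr_suml; apply: ler_sum => i _.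
  by rewrite ComplexField.Normc.normcM ler_wpM2l ?cmod_ge0// ltW.
by rewrite mulrA ler_pdivrMr; nra.
Qed.

End Semisimple.

(** * From the BSE property of the constant 1 to an approximate identity *)

Lemma CBSE1_approximate_identity : CBSE A (fun=> 1) ->
  has_bounded_Delta_weak_approximate_identity A.
Proof.
move=> [_ [M [Mbd [beta [beta0 bse]]]]].
have [K MK] := choice Mbd.
(* [D] is convex and balanced and contains [beta] times [M]; the absolute value keeps 0 in [D] even
   when [M] is empty. *)
pose D := [set a : A | forall l, p l a <= beta * `|K l|].
have Dbd : fbounded D by exact: fsnorm_ball_bounded.
apply/has_bounded_Delta_weak_approximate_identityP; exists D; split=> // n phi eps eps0.
apply: contrapT => far.
pose V := [set (fun i => chi (phi i) a) | a in D].
have D0 : D 0 by move=> l; rewrite fsnorm0 mulr_ge0 ?normr_ge0// ltW.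
have [B hB] := choice (fun i => character_fun_bounded (phi i) Dbd).
have [||||_ [a Da <-]|c [eta [eta0 sep]]] := @convex_point_separation R n V (fun=> 1)
    (\sum_i `|B i|) eps.
- move=> _ _ t [a Da <-] [b Db <-] /andP[t0 t1].
  exists (a + t%:C *: (b - a)).
    move=> l; have -> : a + t%:C *: (b - a) = (1 - t)%:C *: a + t%:C *: b.
      by rewrite scalerBr rmorphB /= scalerBl scale1r addrAC addrA.
    apply: le_trans (fsnormD _ _ _) _; rewrite !fsnormZr ?subr_ge0//.
    by have := Da l; have := Db l; nra.
  apply/funext => i; rewrite character_funD character_funZ character_funD.
  by rewrite -scaleN1r character_funZ mulN1r.
- by exists (fun i => chi (phi i) 0), 0.
- move=> _ i [a Da <-]; apply: le_trans (hB i a Da) _; rewrite (bigD1 i)//=.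
  by rewrite -[X in X <= _]addr0 lerD ?ler_norm// sumr_ge0.
- exact: eps0.
- apply: contrapT => nfar; apply: far; exists a; split=> // i.
  rewrite ltNge; apply/negP => h; apply: nfar; exists i.
  by rewrite -cmodN opprB.
have := bse n c phi; under eq_bigr do rewrite mulr1.
set F := fun a : A => _.
have sep1 w : V w -> complex.Re (\sum_i c i * w i) + eta <= cmod (\sum_i c i).
  move=> Vw; apply: le_trans (Re_le_cmod _).
  by have := sep w Vw; under [X in _ <= complex.Re X]eq_bigr do rewrite mulr1.
have FM a : M a -> beta * cmod (F a) + eta <= cmod (\sum_i c i).
  move=> Ma.
  (* Rotating [a] by the phase [s] inside the balanced set [D] upgrades the bound on the real part
     to one on the modulus. *)
  have [s s1 sF] : exists2 s, cmod s = 1 & s * F a = (cmod (F a))%:C.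
    have [F0|F0] := eqVneq (F a) 0.
      by exists 1; rewrite ?ComplexField.Normc.normc1 ?F0 ?mulr0 ?ComplexField.Normc.normc0.
    have cF0 : cmod (F a) != 0.
      by apply: contra F0 => /eqP/ComplexField.Normc.eq0_normc ->.
    exists ((cmod (F a))%:C / F a); last by rewrite divfK.
    rewrite ComplexField.Normc.normcM ComplexField.Normc.normcV.
    by rewrite cmod_real ger0_norm ?cmod_ge0 ?divff.
  have Dsa : D ((beta%:C * s) *: a).
    move=> l; rewrite fsnormZ ComplexField.Normc.normcM s1 mulr1 cmod_real gtr0_norm//.
    by rewrite ler_pM2l// (le_trans (MK l a Ma))// ler_norm.
  have := sep1 _ (imageP (fun a i => chi (phi i) a) Dsa).
  under eq_bigr do rewrite character_funZ mulrCA.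
  by rewrite -mulr_sumr -mulrA -/(F a) sF -rmorphM.
(* The supremum of [FM] over [M] beats the BSE inequality by [eta]. For empty [M], [PM] is 0 by
   convention, and [0] in [D] gives the contradiction. *)
have [[a0 Ma0]|M0] := EM (M !=set0).
  rewrite leNgt => /negP; apply.
  have : PM M F <= (cmod (\sum_i c i) - eta) / beta.
    apply: ge_sup; first by exists (cmod (F a0)), a0.
    by move=> _ [a Ma <-]; rewrite ler_pdivlMr// mulrC; have := FM a Ma; lra.
  by rewrite ler_pdivlMr// mulrC; lra.
have -> : M = set0 by apply/seteqP; split=> // a Ma; case: M0; exists a.
rewrite /PM image_set0 sup0 mulr0.
have := sep1 _ (imageP (fun a i => chi (phi i) a) D0).
rewrite [X in complex.Re X]big1 => [|i _]; last by rewrite character_fun0 mulr0.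
by rewrite /=; lra.
Qed.

End Spectrum.

Theorem theorem3p5 (R : realType) (A : frechetAlgType R)
    (fmulC : commutative (@fmul R A)) (ssA : semisimple A) :
  multipliers_hat A `<=` CBSE A <->
  has_bounded_Delta_weak_approximate_identity A.
Proof.
split=> [sub|e _ [T mT <-]]; last exact: mult_hat_CBSE.
apply: CBSE1_approximate_identity; apply: sub; exists id => //.
apply/funext => phi; have [_ _ _ [a a0]] := character_funP phi.
by rewrite (@mult_hatE _ _ id phi a)// divff.
Qed.
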